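(* Let $(\mathcal{C},U)$ be a morpho-category and let $b:U(t)\to|\mathcal{C}|$ be a structuring element. Then $\varepsilon[b]$ and $\delta[b]$: (1) are monotonic: for all $d,d'\in|\mathcal{C}|$, if $d\rightarrowtail d'$ then $\varepsilon[b](d)\rightarrowtail\varepsilon[b](d')$ and $\delta[b](d)\rightarrowtail\delta[b](d')$; (2) commute with $\bigwedge$ and $\bigvee$, respectively: for every diagram $\mathcal{D}$ in $\mathcal{C}$, $\varepsilon[b](\bigwedge\mathcal{D})=\bigwedge\{\varepsilon[b](d)\mid d\in\mathcal{D}\}$ and $\delta[b](\bigvee\mathcal{D})=\bigvee\{\delta[b](d)\mid d\in\mathcal{D}\}$; (3) satisfy the preservation properties: $\varepsilon[b](t)=t$ and $\delta[b](\emptyset)=\emptyset$.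
   Context: A morpho-category is a category $\mathcal{C}$ together with a functor $U:\mathcal{C}\to\mathrm{Set}$ such that: $\mathcal{C}$ is complete and co-complete; the morphisms of $\mathcal{C}$ define a partial order on its objects, written $c\rightarrowtail c'$ (so there is at most one morphism between two objects, it is a monic, and the relation is antisymmetric); and $U$ preserves monics (so $U(f)$ is injective for every morphism $f$) and colimits. $|\mathcal{C}|$ is the class of objects. $\bigwedge D$ and $\bigvee D$ denote the limit (infimum) and colimit (supremum) of a diagram $D$; a set of objects $\{c\in|\mathcal{C}|\mid P(c)\}$ is regarded as the diagram consisting of these objects and all morphisms of $\mathcal{C}$ between them. $\emptyset$ is the initial object and $t$ the terminal object of $\mathcal{C}$. For $c\in|\mathcal{C}|$ and $x\in U(c)$, $x_t:=U(c\rightarrowtail t)(x)\in U(t)$. A structuring element is a mapping $b:U(t)\to|\mathcal{C}|$. The erosion over $b$ is $\varepsilon[b](d)=\bigvee D^\varepsilon_d$ with $D^\varepsilon_d=\{e\in|\mathcal{C}|\mid\forall v\in U(e),\ b(v_t)\rightarrowtail d\}$. The dilation over $b$ is $\delta[b](d)=\bigwedge D^\delta_d$ with $D^\delta_d=\{e\in|\mathcal{C}|\mid\forall v\in U(d),\ b(v_t)\rightarrowtail e\}$. *)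

(* Defs.v *)
From mathcomp Require Import all_boot boolp classical_sets.

Set Implicit Arguments.
Unset Strict Implicit.
Unset Printing Implicit Defensive.

Local Open Scope classical_set_scope.

Record category := Category {
  obj :> Type;
  hom : obj -> obj -> Type;
  idm : forall a, hom a a;
  compm : forall a b c, hom b c -> hom a b -> hom a c;
  compm1l : forall a b (f : hom a b), compm (idm b) f = f;
  compm1r : forall a b (f : hom a b), compm f (idm a) = f;
  compmA : forall a b c d (h : hom c d) (g : hom b c) (f : hom a b),
    compm h (compm g f) = compm (compm h g) f }.

Record functor (C D : category) := Functor {
  fobj :> C -> D;
  fmap : forall a b : C, hom a b -> hom (fobj a) (fobj b);
  fmap1 : forall a : C, fmap (idm a) = idm (fobj a);
  fmapM : forall (a b c : C) (g : hom b c) (f : hom a b),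
    fmap (compm g f) = compm (fmap g) (fmap f) }.

Definition setCat : category :=
  @Category Type (fun A B => A -> B) (fun A x => x)
    (fun A B C g f x => g (f x))
    (fun _ _ _ => erefl) (fun _ _ _ => erefl) (fun _ _ _ _ _ _ _ => erefl).

Section Composition.
Variables (A B C : category) (G : functor B C) (F : functor A B).

Lemma fcomp_map1 (a : A) : fmap G (fmap F (idm a)) = idm (G (F a)).
Proof. by rewrite !fmap1. Qed.

Lemma fcomp_mapM (a b c : A) (g : hom b c) (f : hom a b) :
  fmap G (fmap F (compm g f)) =
  compm (fmap G (fmap F g)) (fmap G (fmap F f)).
Proof. by rewrite !fmapM. Qed.

Definition fcomp : functor A C :=
  @Functor A C (fun a => G (F a)) (fun a b f => fmap G (fmap F f))
    fcomp_map1 fcomp_mapM.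

End Composition.

Section FullSubcategory.
Variables (C : category) (P : set C).

Definition fullsub : category :=
  @Category {c : C | P c} (fun x y => hom (sval x) (sval y))
    (fun x => idm (sval x)) (fun x y z g f => compm g f)
    (fun _ _ f => compm1l f) (fun _ _ f => compm1r f)
    (fun _ _ _ _ h g f => compmA h g f).

(* The set of objects P as a diagram: the objects satisfying P together with
   all the morphisms of C between them. *)
Definition set_diagram : functor fullsub C :=
  @Functor fullsub C (fun x => sval x) (fun _ _ f => f)
    (fun _ => erefl) (fun _ _ _ _ _ => erefl).

End FullSubcategory.

Section Limits.
Variables (J C : category) (D : functor J C).

Definition is_cone (c : C) (p : forall j, hom c (D j)) :=
  forall (i j : J) (u : hom i j), compm (fmap D u) (p i) = p j.

Definition is_limit (c : C) (p : forall j, hom c (D j)) :=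
  is_cone p /\
  forall (c' : C) (p' : forall j, hom c' (D j)), is_cone p' ->
    exists! h : hom c' c, forall j, compm (p j) h = p' j.

Definition is_cocone (c : C) (q : forall j, hom (D j) c) :=
  forall (i j : J) (u : hom i j), compm (q j) (fmap D u) = q i.

Definition is_colimit (c : C) (q : forall j, hom (D j) c) :=
  is_cocone q /\
  forall (c' : C) (q' : forall j, hom (D j) c'), is_cocone q' ->
    exists! h : hom c c', forall j, compm h (q j) = q' j.

End Limits.

(* The index category J ranges over a universe that may contain C itself: the
   diagrams whose (co)limits define erosion and dilation have as many objects
   as a subclass of |C|. *)
Definition complete (C : category) :=
  forall (J : category) (D : functor J C),
    exists (c : C) (p : forall j, hom c (D j)), is_limit p.

Definition cocomplete (C : category) :=
  forall (J : category) (D : functor J C),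
    exists (c : C) (q : forall j, hom (D j) c), is_colimit q.

Definition monic (C : category) (a b : C) (f : hom a b) :=
  forall (c : C) (g h : hom c a), compm f g = compm f h -> g = h.

Definition preserves_monics (C D : category) (F : functor C D) :=
  forall (a b : C) (f : hom a b), monic f -> monic (fmap F f).

Definition preserves_colimit (J C E : category) (F : functor C E)
    (D : functor J C) :=
  forall (c : C) (q : forall j, hom (D j) c),
    is_colimit q -> is_colimit (D := fcomp F D) (fun j => fmap F (q j)).

Definition arrow (C : category) (c c' : C) : Prop := inhabited (hom c c').

Notation "c ~> c'" := (arrow c c') (at level 70, no associativity).

(* Colimit preservation is required for the diagrams given by sets of objects
   with all the morphisms between them.  Quantifying over arbitrary functors
   into C instead would leave only the constantly empty U: in a thin category
   the coproduct of c with itself is c, so the codiagonal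
   U c + U c -> U c would be a bijection. *)
Record morphoCategory := MorphoCategory {
  mcat :> category;
  U : functor mcat setCat;
  mcat_complete : complete mcat;
  mcat_cocomplete : cocomplete mcat;
  mcat_thin : forall (c c' : mcat) (f g : hom c c'), f = g;
  mcat_anti : forall c c' : mcat, c ~> c' -> c' ~> c -> c = c';
  U_monics : preserves_monics U;
  U_colimits : forall P : set mcat, preserves_colimit U (set_diagram P) }.

Arguments U {_}.

Section Operators.
Variable M : morphoCategory.

(* In M (co)limits are unique on the nose, so the choices below are not
   significant. *)
Definition lim (J : category) (D : functor J M) : M :=
  projT1 (cid (mcat_complete D)).

Definition colim (J : category) (D : functor J M) : M :=
  projT1 (cid (mcat_cocomplete D)).

Definition inf (P : set M) : M := lim (set_diagram P).

Definition sup (P : set M) : M := colim (set_diagram P).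

End Operators.

Definition is_terminal (C : category) (t : C) :=
  forall c : C, exists f : hom c t, forall g : hom c t, g = f.

Definition is_initial (C : category) (i : C) :=
  forall c : C, exists f : hom i c, forall g : hom i c, g = f.

Section Morphology.
Variables (M : morphoCategory) (t : M) (tP : is_terminal t).

Definition to_terminal (c : M) : hom c t := projT1 (cid (tP c)).

(* x |-> x_t *)
Definition in_terminal (c : M) (x : U c) : U t := fmap U (to_terminal c) x.

Definition erosion (b : U t -> M) (d : M) : M :=
  sup [set e : M | forall v : U e, b (in_terminal v) ~> d].

Definition dilation (b : U t -> M) (d : M) : M :=
  inf [set e : M | forall v : U d, b (in_terminal v) ~> e].

End Morphology.

(* Main.v *)
Require Import Defs.
From mathcomp Require Import all_boot boolp classical_sets.

Local Open Scope classical_set_scope.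

(** Erosion and dilation over [b] form a Galois connection,
    [dilation tP b d ~> e] iff [d ~> erosion tP b e] ([dilation_erosion_adj]),
    and everything follows from it in the partial order of objects: adjoints are
    monotone, the right adjoint preserves infima and the left adjoint suprema,
    the right adjoint fixes the top and the left adjoint the bottom.

    Both sides of the equivalence say that [b (in_terminal tP v) ~> e] for every
    point [v] of [d].  For dilation this is the universal property of an infimum
    of upper bounds ([dilation_le]).  For erosion ([le_erosion]) it says that the
    supremum of the objects having this property has it again, and this is where
    the functor [U] matters: since [U] preserves that colimit, and the injections
    into a colimit of sets are jointly surjective ([colimit_set_surj]), each point
    of the supremum comes from a point of one of those objects, with the same
    image in [U t]. *)

(** The predicate of being hit by some injection and the constantly true
    predicate agree on the diagram, so they agree on its colimit. *)
Lemma colimit_set_surj {J : category} {D : functor J setCat} {c : setCat}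
    {q : forall j, hom (D j) c} :
  is_colimit q -> forall y : c, exists j (x : D j), q j x = y.
Proof.
move=> [_ univ] y.
have cocone_true : is_cocone (D := D) (c := Prop : setCat) (fun j _ => True).
  by [].
have [h [_ h_uniq]] := univ _ _ cocone_true.
have h_true : h = (fun=> True) by exact: h_uniq.
have h_image : h = (fun z => exists j (x : D j), q j x = z).
  apply: h_uniq => j; apply/funext => x; apply/propext.
  by split=> // _; exists j, x.
by have := congr1 (fun f => f y) (etrans (esym h_image) h_true) => /= ->.
Qed.

Section MorphoOrder.
Context {M : morphoCategory}.

Lemma arrow_refl (c : M) : c ~> c.
Proof. exact: inhabits (idm c). Qed.

Lemma arrow_trans {a c d : M} : a ~> c -> c ~> d -> a ~> d.
Proof. by move=> [f] [g]; exact: inhabits (compm g f). Qed.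

Lemma le_lim (J : category) (D : functor J M) (c : M) :
  c ~> lim D <-> forall j, c ~> D j.
Proof.
rewrite /lim; case: cid => l [p [_ univ]] /=; split=> [cl j|cD].
  exact: arrow_trans cl (inhabits (p j)).
have cone_c : is_cone (fun j => inhabited_witness (cD j)).
  by move=> *; exact: mcat_thin.
by have [h _] := univ _ _ cone_c; exact: inhabits h.
Qed.

Lemma colim_le (J : category) (D : functor J M) (c : M) :
  colim D ~> c <-> forall j, D j ~> c.
Proof.
rewrite /colim; case: cid => l [q [_ univ]] /=; split=> [lc j|Dc].
  exact: arrow_trans (inhabits (q j)) lc.
have cocone_c : is_cocone (fun j => inhabited_witness (Dc j)).
  by move=> *; exact: mcat_thin.
by have [h _] := univ _ _ cocone_c; exact: inhabits h.
Qed.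

Lemma le_inf (P : set M) (c : M) : c ~> inf P <-> forall e, P e -> c ~> e.
Proof.
rewrite /inf le_lim; split=> [cP e Pe|cP [e Pe]]; last exact: cP.
exact: cP (exist _ e Pe).
Qed.

Lemma sup_le (P : set M) (c : M) : sup P ~> c <-> forall e, P e -> e ~> c.
Proof.
rewrite /sup colim_le; split=> [Pc e Pe|Pc [e Pe]]; last exact: Pc.
exact: Pc (exist _ e Pe).
Qed.

Lemma inf_lower (P : set M) (e : M) : P e -> inf P ~> e.
Proof. by move: e; apply/le_inf; exact: arrow_refl. Qed.

Lemma sup_upper (P : set M) (e : M) : P e -> e ~> sup P.
Proof. by move: e; apply/sup_le; exact: arrow_refl. Qed.

Lemma arrow_eq_below (a a' : M) : (forall c, c ~> a <-> c ~> a') -> a = a'.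
Proof.
by move=> aa'; apply: mcat_anti; apply/aa'; exact: arrow_refl.
Qed.

Lemma arrow_eq_above (a a' : M) : (forall c, a ~> c <-> a' ~> c) -> a = a'.
Proof.
by move=> aa'; apply: mcat_anti; apply/aa'; exact: arrow_refl.
Qed.

(** Preservation of this colimit by [U] turns [U (sup P)] into a colimit of sets,
    whose points can be traced back. *)
Lemma sup_point {P : set M} (v : U (sup P)) :
  exists e : M, P e /\ exists (f : hom e (sup P)) (x : U e), fmap U f x = v.
Proof.
move: v; rewrite /sup /colim; case: cid => s [q q_colim] /= v.
have [[e Pe] [x qx]] := colimit_set_surj (U_colimits q_colim) v.
by exists e; split=> //; exists (q (exist _ e Pe)), x.
Qed.

End MorphoOrder.

Section GaloisConnection.
Variables (M : morphoCategory) (t : M) (tP : is_terminal t) (b : U t -> M).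

Lemma in_terminal_fmap {c d : M} (f : hom c d) (x : U c) :
  in_terminal tP (fmap U f x) = in_terminal tP x.
Proof.
rewrite /in_terminal (mcat_thin (to_terminal tP c) (compm (to_terminal tP d) f)).
by rewrite fmapM.
Qed.

(** A point of [c], sent into the supremum defining the erosion, is also the image
    of a point of some member [e] of the defining family, where the condition is
    known; both points have the same image in [U t], since there is at most one
    morphism to [t]. *)
Lemma le_erosion (c d : M) :
  c ~> erosion tP b d <-> forall v : U c, b (in_terminal tP v) ~> d.
Proof.
split=> [[g] v|cd]; last exact: sup_upper.
rewrite -(in_terminal_fmap g).
have [e [ed [f [x <-]]]] := sup_point (fmap U g v).
by rewrite in_terminal_fmap; exact: ed.
Qed.

Lemma dilation_le (d e : M) :
  dilation tP b d ~> e <-> forall v : U d, b (in_terminal tP v) ~> e.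
Proof.
split=> [de v|de]; last exact: inf_lower.
by apply: arrow_trans de; apply/le_inf => e'; exact.
Qed.

Lemma dilation_erosion_adj (d e : M) :
  dilation tP b d ~> e <-> d ~> erosion tP b e.
Proof. by rewrite dilation_le le_erosion. Qed.

Lemma erosion_mono (d d' : M) : d ~> d' -> erosion tP b d ~> erosion tP b d'.
Proof.
move=> dd'; apply/dilation_erosion_adj/(arrow_trans _ dd').
by apply/dilation_erosion_adj; exact: arrow_refl.
Qed.

Lemma dilation_mono (d d' : M) :
  d ~> d' -> dilation tP b d ~> dilation tP b d'.
Proof.
move=> dd'; apply/dilation_erosion_adj/(arrow_trans dd').
by apply/dilation_erosion_adj; exact: arrow_refl.
Qed.

Lemma erosion_lim (J : category) (D : functor J M) :
  erosion tP b (lim D) = inf [set e | exists j, e = erosion tP b (D j)].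
Proof.
apply: arrow_eq_below => c; rewrite -dilation_erosion_adj le_lim le_inf.
split=> [cD _ [j ->]|cD j]; first exact/dilation_erosion_adj.
by apply/dilation_erosion_adj/cD; exists j.
Qed.

Lemma dilation_colim (J : category) (D : functor J M) :
  dilation tP b (colim D) = sup [set e | exists j, e = dilation tP b (D j)].
Proof.
apply: arrow_eq_above => c; rewrite dilation_erosion_adj colim_le sup_le.
split=> [Dc _ [j ->]|Dc j]; first exact/dilation_erosion_adj.
by apply/dilation_erosion_adj/Dc; exists j.
Qed.

Lemma erosion_terminal : erosion tP b t = t.
Proof.
have le_t c : c ~> t by exact: inhabits (to_terminal tP c).
by apply: mcat_anti => //; apply/dilation_erosion_adj.
Qed.

Lemma dilation_initial (i : M) : is_initial i -> dilation tP b i = i.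
Proof.
move=> iP; have i_le c : i ~> c by have [f _] := iP c; exact: inhabits f.
by apply: mcat_anti => //; apply/dilation_erosion_adj.
Qed.

End GaloisConnection.

Theorem theorem4p16 (M : morphoCategory) (t : M) (tP : is_terminal t)
    (i : M) (iP : is_initial i) (b : U t -> M) :
  (* (1) *)
  (forall d d' : M, d ~> d' ->
     erosion tP b d ~> erosion tP b d' /\
     dilation tP b d ~> dilation tP b d') /\
  (* (2) *)
  (forall (J : category) (D : functor J M),
     erosion tP b (lim D) = inf [set e : M | exists j : J, e = erosion tP b (D j)] /\
     dilation tP b (colim D) = sup [set e : M | exists j : J, e = dilation tP b (D j)]) /\
  (* (3) *)
  (erosion tP b t = t /\ dilation tP b i = i).
Proof.
split=> [d d' dd'|]; first by split; [exact: erosion_mono|exact: dilation_mono].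
split=> [J D|]; first by split; [exact: erosion_lim|exact: dilation_colim].
by split; [exact: erosion_terminal|exact: dilation_initial].
Qed.
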